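(* Let $\tilde{\mathbb{T}}$ be a time scale. Assume that $\varphi:\tilde{\mathbb{T}}\to\mathbb{R}$ is a strictly increasing continuous function and that $\mathbb{T}=\varphi(\tilde{\mathbb{T}})$ is a time scale. Moreover, let $\varphi$ map an interval $[A,B]_{\tilde{\mathbb{T}}}$ onto $[a,b]_{\mathbb{T}}$, where $A,B\in\tilde{\mathbb{T}}$, $A<B$, and $a,b\in\mathbb{T}$, $a<b$. Let $\Box\in\{\Delta,\nabla\}$, let $g$ be a (strictly) monotonically increasing real function on $[a,b]_{\mathbb{T}}$, and let $f\in\mathcal{R}_{\Box}(g,[a,b]_{\mathbb{T}})$. Then $f\circ\varphi\in\mathcal{R}_{\Box}(g\circ\varphi,[A,B]_{\tilde{\mathbb{T}}})$ and $$\int_a^b f(t)\,\Box g(t)=\int_A^B f(\varphi(s))\,\Box g(\varphi(s)),$$ where the left-hand integral is taken on the time scale $\mathbb{T}$ and the right-hand integral (of $f\circ\varphi$ with respect to $g\circ\varphi$) on the time scale $\tilde{\mathbb{T}}$.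
   Context: A time scale $\mathbb{T}$ is a nonempty closed subset of $\mathbb{R}$, with the induced topology. The jump operators are $\sigma(t)=\inf\{s\in\mathbb{T}: s>t\}$ and $\rho(t)=\sup\{s\in\mathbb{T}: s<t\}$ (with $\sigma(\max\mathbb{T})=\max\mathbb{T}$, $\rho(\min\mathbb{T})=\min\mathbb{T}$ when these exist). For $a<b$ in $\mathbb{T}$: $[a,b]_{\mathbb{T}}=[a,b]\cap\mathbb{T}$, $[a,b]_{\Delta}=[a,\rho(b)]_{\mathbb{T}}$, $[a,b]_{\nabla}=[\sigma(a),b]_{\mathbb{T}}$. The symbol $\Box$ stands for $\Delta$ or $\nabla$, the same choice throughout. The analogous notions apply to $\tilde{\mathbb{T}}$ with its own jump operators. $\mathcal{P}(I)$ is the set of partitions of $I=[a,b]_{\mathbb{T}}$, i.e. finite sets $P=\{t_0,\ldots,t_n\}\subset I$ with $a=t_0<\cdots<t_n=b$. For $f$ bounded and $g$ strictly increasing on $I$ and $P\in\mathcal{P}(I)$ put $\Delta g_j=g(t_j)-g(t_{j-1})$, $I_{\Box j}=[t_{j-1},t_j]_{\Box}$, $m_{\Box j}=\inf_{I_{\Box j}}f$, $M_{\Box j}=\sup_{I_{\Box j}}f$, and $$U_{\Box}(P,f,g)=\sum_{j=1}^n M_{\Box j}\Delta g_j,\qquad L_{\Box}(P,f,g)=\sum_{j=1}^n m_{\Box j}\Delta g_j .$$ The upper and lower Darboux-Stieltjes $\Box$-integrals are $\overline{\int_a^b}f\,\Box g=\inf_{P\in\mathcal{P}(I)}U_{\Box}(P,f,g)$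 and $\underline{\int_a^b}f\,\Box g=\sup_{P\in\mathcal{P}(I)}L_{\Box}(P,f,g)$. If they are equal, $f$ is called Riemann-Stieltjes $\Box$-integrable with respect to $g$ on $I$, the common value is denoted $\int_a^b f\,\Box g$, and $\mathcal{R}_{\Box}(g,I)$ is the set of all such (bounded) $f$. *)

(* Defs.v *)
From mathcomp Require Export all_boot all_order all_algebra.
From mathcomp Require Export all_classical all_reals all_analysis.

Set Implicit Arguments.
Unset Strict Implicit.
Unset Printing Implicit Defensive.

Import Order.TTheory GRing.Theory Num.Theory.
Import numFieldNormedType.Exports.

Local Open Scope classical_set_scope.
Local Open Scope ring_scope.

Definition time_scale (R : realType) (T : set R) : Prop :=
  T !=set0 /\ closed T.

(* For t in T, the set of larger points of T is empty exactly when t = max T.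
   The case split implements sigma (max T) = max T, since the library's inf of
   the empty set is 0; dually for rho. *)
Definition jump_fwd (R : realType) (T : set R) (t : R) : R :=
  let A := [set s | T s /\ t < s] in if A == set0 then t else inf A.

Definition jump_bwd (R : realType) (T : set R) (t : R) : R :=
  let A := [set s | T s /\ s < t] in if A == set0 then t else sup A.

Definition ts_itv (R : realType) (T : set R) (a b : R) : set R :=
  [set` `[a, b]] `&` T.

Variant box : Set := Delta | Nabla.

Definition box_itv (R : realType) (bx : box) (T : set R) (a b : R) : set R :=
  match bx with
  | Delta => ts_itv T a (jump_bwd T b)
  | Nabla => ts_itv T (jump_fwd T a) b
  end.

(* The partition a = t_0 < t_1 < ... < t_n = b is represented by the sequence
   s = [:: t_1; ...; t_n], as in itv_partition; t_j is then nth b (a :: s) j. *)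
Definition ts_partition (R : realType) (T : set R) (a b : R) (s : seq R) :
    Prop :=
  itv_partition a b s /\ forall x, x \in a :: s -> ts_itv T a b x.

Definition upper_sum (R : realType) (bx : box) (T : set R) (f g : R -> R)
    (a b : R) (s : seq R) : R :=
  let t := nth b (a :: s) in
  \sum_(0 <= j < size s)
    sup (f @` box_itv bx T (t j) (t j.+1)) * (g (t j.+1) - g (t j)).

Definition lower_sum (R : realType) (bx : box) (T : set R) (f g : R -> R)
    (a b : R) (s : seq R) : R :=
  let t := nth b (a :: s) in
  \sum_(0 <= j < size s)
    inf (f @` box_itv bx T (t j) (t j.+1)) * (g (t j.+1) - g (t j)).

(* For f bounded and g strictly increasing on [a, b]_T, where a < b are in T,
   every inf and sup in this file is that of a nonempty bounded set, so the
   real-valued inf and sup agree with the usual ones. *)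
Definition upper_integral (R : realType) (bx : box) (T : set R)
    (f g : R -> R) (a b : R) : R :=
  inf [set upper_sum bx T f g a b s | s in ts_partition T a b].

Definition lower_integral (R : realType) (bx : box) (T : set R)
    (f g : R -> R) (a b : R) : R :=
  sup [set lower_sum bx T f g a b s | s in ts_partition T a b].

Definition RS_integrable (R : realType) (bx : box) (T : set R)
    (g : R -> R) (a b : R) : set (R -> R) :=
  [set f : R -> R | [bounded f x | x in ts_itv T a b] /\
    upper_integral bx T f g a b = lower_integral bx T f g a b].

(* Meaningful only for f in RS_integrable bx T g a b: it is then the common
   value of the upper and lower integrals. *)
Definition RS_integral (R : realType) (bx : box) (T : set R)
    (f g : R -> R) (a b : R) : R :=
  upper_integral bx T f g a b.

(* Main.v *)
Require Import Defs.
From mathcomp Require Import all_boot all_order all_algebra.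
From mathcomp Require Import all_classical all_reals all_analysis.
Import Order.TTheory GRing.Theory Num.Theory.
Import numFieldNormedType.Exports.
Local Open Scope classical_set_scope.
Local Open Scope ring_scope.

(** The map [phi] is an isomorphism of ordered sets from [Tt] onto [T], and all
    the ingredients of a Darboux sum are carried along by such an isomorphism.
    The endpoints correspond, being the extreme points of intervals that are
    mapped onto each other, and so do the partitions: [s |-> map phi s] is onto
    the partitions of [a, b] in [T].  The one ingredient that refers to the
    ambient real line is the jump operators, which are infima and suprema taken
    in [R].  But both time scales are closed, so these bounds belong to the time
    scales, where they are order-theoretic notions; hence [phi] commutes with
    the jumps ([image_jump_fwd], [image_jump_bwd]) and maps each interval
    [t_(j-1), t_j] of type Delta or Nabla onto the corresponding one
    ([image_box_itv]).  Therefore corresponding partitions have equal upper sums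
    and equal lower sums, the two sides have the same sets of upper sums and of
    lower sums, and the integrals agree. *)

(** * Bounds in closed sets *)

Lemma closed_sup_mem (R : realType) (T S : set R) :
  closed T -> S `<=` T -> S !=set0 -> has_ubound S -> T (sup S).
Proof.
move=> clT ST S0 Sub; apply: clT.
exact: (closureS ST) (closure_sup S0 Sub).
Qed.

Lemma closed_inf_mem (R : realType) (T S : set R) :
  closed T -> S `<=` T -> S !=set0 -> has_lbound S -> T (inf S).
Proof.
move=> clT ST S0 Slb.
suff : (-%R @^-1` T) (sup (-%R @` S)) by [].
apply: closed_sup_mem.
- by apply: preimage_closed => // x _; exact: opp_continuous.
- by move=> _ [x Sx <-] /=; rewrite opprK; exact: ST.
- by case: S0 => x Sx; exists (- x), x.
- exact/has_lb_ubN.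
Qed.

(** The supremum of the image lies in the closed set [phi @` Tt], so it is
    [phi w] for some [w] in [Tt].  As [phi] reflects the order, [w] bounds [S],
    whence [sup S <= w]; conversely [phi (sup S)] bounds the image because
    [sup S] lies in [Tt], where [phi] is monotone. *)
Lemma image_sup (R : realType) (Tt S : set R) (phi : R -> R) (t : R) :
  closed Tt -> closed (phi @` Tt) ->
  {in Tt &, {mono phi : x y / x <= y}} ->
  S `<=` Tt -> S !=set0 -> Tt t -> ubound S t ->
  phi (sup S) = sup (phi @` S).
Proof.
move=> clTt clT phi_mono STt S0 Ttt St.
have Sub : has_ubound S by exists t.
have TtS : Tt (sup S) by exact: closed_sup_mem.
have phiS0 : phi @` S !=set0 by case: S0 => x Sx; exists (phi x), x.
have ubS : ubound (phi @` S) (phi (sup S)).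
  move=> _ [x Sx <-]; have Ttx := STt _ Sx.
  by rewrite phi_mono ?inE//; exact: ub_le_sup.
have [w Ttw wE] : (phi @` Tt) (sup (phi @` S)).
  apply: closed_sup_mem => //; last by exists (phi (sup S)).
  exact: image_subset.
apply/eqP; rewrite eq_le [X in _ && X]ge_sup// andbT -wE phi_mono ?inE//.
apply: ge_sup => // x Sx; have Ttx := STt _ Sx.
rewrite -phi_mono ?inE// wE; apply: ub_le_sup; last by exists x.
by exists (phi (sup S)).
Qed.

Lemma image_inf (R : realType) (Tt S : set R) (phi : R -> R) (t : R) :
  closed Tt -> closed (phi @` Tt) ->
  {in Tt &, {mono phi : x y / x <= y}} ->
  S `<=` Tt -> S !=set0 -> Tt t -> lbound S t ->
  phi (inf S) = inf (phi @` S).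
Proof.
move=> clTt clT phi_mono STt S0 Ttt St.
have Slb : has_lbound S by exists t.
have TtS : Tt (inf S) by exact: closed_inf_mem.
have phiS0 : phi @` S !=set0 by case: S0 => x Sx; exists (phi x), x.
have lbS : lbound (phi @` S) (phi (inf S)).
  move=> _ [x Sx <-]; have Ttx := STt _ Sx.
  by rewrite phi_mono ?inE//; exact: ge_inf.
have [w Ttw wE] : (phi @` Tt) (inf (phi @` S)).
  apply: closed_inf_mem => //; last by exists (phi (inf S)).
  exact: image_subset.
apply/eqP; rewrite eq_le lb_le_inf//= -wE phi_mono ?inE//.
apply: lb_le_inf => // x Sx; have Ttx := STt _ Sx.
rewrite -phi_mono ?inE// wE; apply: ge_inf; last by exists x.
by exists (phi (inf S)).
Qed.

(** * Jump operators and intervals *)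

(** These memberships are what allows [image_ts_itv] to be applied to an
    interval that ends at a jump. *)
Lemma jump_fwd_mem (R : realType) (T : set R) (t : R) :
  closed T -> T t -> T (jump_fwd T t).
Proof.
move=> clT Tt; rewrite /jump_fwd; case: eqVneq => // /set0P S0.
apply: closed_inf_mem => //; first by move=> x [].
by exists t => x [_ /ltW].
Qed.

Lemma jump_bwd_mem (R : realType) (T : set R) (t : R) :
  closed T -> T t -> T (jump_bwd T t).
Proof.
move=> clT Tt; rewrite /jump_bwd; case: eqVneq => // /set0P S0.
apply: closed_sup_mem => //; first by move=> x [].
by exists t => x [_ /ltW].
Qed.

Lemma image_jump_fwd (R : realType) (Tt : set R) (phi : R -> R) (t : R) :
  closed Tt -> closed (phi @` Tt) ->
  {in Tt &, {mono phi : x y / x <= y}} -> Tt t ->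
  phi (jump_fwd Tt t) = jump_fwd (phi @` Tt) (phi t).
Proof.
move=> clTt clT phi_mono Ttt.
have lt_mono := leW_mono_in phi_mono.
have SE : [set x | (phi @` Tt) x /\ phi t < x] =
          phi @` [set s | Tt s /\ t < s].
  apply/seteqP; split => [_ [[s Tts <-] +]|_ [s [Tts ts] <-]] /=.
    by rewrite lt_mono ?inE// => ts; exists s.
  by split; [exists s|rewrite lt_mono ?inE].
rewrite /jump_fwd SE; case: eqVneq => [->|S0].
  by rewrite image_set0 eqxx.
case: eqVneq => [/image_set0_set0 /eqP|_]; first by rewrite (negbTE S0).
apply: (image_inf _ _ _ _ t clTt) => //; first by move=> x [].
  exact/set0P.
by move=> x [_ /ltW].
Qed.

Lemma image_jump_bwd (R : realType) (Tt : set R) (phi : R -> R) (t : R) :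
  closed Tt -> closed (phi @` Tt) ->
  {in Tt &, {mono phi : x y / x <= y}} -> Tt t ->
  phi (jump_bwd Tt t) = jump_bwd (phi @` Tt) (phi t).
Proof.
move=> clTt clT phi_mono Ttt.
have lt_mono := leW_mono_in phi_mono.
have SE : [set x | (phi @` Tt) x /\ x < phi t] =
          phi @` [set s | Tt s /\ s < t].
  apply/seteqP; split => [_ [[s Tts <-] +]|_ [s [Tts st] <-]] /=.
    by rewrite lt_mono ?inE// => st; exists s.
  by split; [exists s|rewrite lt_mono ?inE].
rewrite /jump_bwd SE; case: eqVneq => [->|S0].
  by rewrite image_set0 eqxx.
case: eqVneq => [/image_set0_set0 /eqP|_]; first by rewrite (negbTE S0).
apply: (image_sup _ _ _ _ t clTt) => //; first by move=> x [].
  exact/set0P.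
by move=> x [_ /ltW].
Qed.

Lemma image_ts_itv (R : realType) (Tt : set R) (phi : R -> R) (u v : R) :
  {in Tt &, {mono phi : x y / x <= y}} -> Tt u -> Tt v ->
  phi @` ts_itv Tt u v = ts_itv (phi @` Tt) (phi u) (phi v).
Proof.
move=> phi_mono Ttu Ttv; rewrite /ts_itv.
apply/seteqP; split => [_ [x [/= xuv Ttx] <-]|y [/= + [x Ttx xy]]].
  split; last by exists x.
  by move: xuv; rewrite /= !in_itv/= !phi_mono ?inE.
by rewrite -xy in_itv/= !phi_mono ?inE// => xuv; exists x => //; split.
Qed.

Lemma image_box_itv (R : realType) (bx : box) (Tt : set R) (phi : R -> R)
    (u v : R) :
  closed Tt -> closed (phi @` Tt) ->
  {in Tt &, {mono phi : x y / x <= y}} -> Tt u -> Tt v ->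
  phi @` box_itv bx Tt u v = box_itv bx (phi @` Tt) (phi u) (phi v).
Proof.
move=> clTt clT phi_mono Ttu Ttv; case: bx => /=.
  by rewrite image_ts_itv ?image_jump_bwd//; exact: jump_bwd_mem.
by rewrite image_ts_itv ?image_jump_fwd//; exact: jump_fwd_mem.
Qed.

(** * Partitions and Darboux sums *)

Lemma upper_sum_map (R : realType) (bx : box) (Tt : set R) (phi f g : R -> R)
    (A B : R) (s : seq R) :
  closed Tt -> closed (phi @` Tt) ->
  {in Tt &, {mono phi : x y / x <= y}} -> {subset A :: s <= Tt} ->
  upper_sum bx (phi @` Tt) f g (phi A) (phi B) (map phi s) =
  upper_sum bx Tt (f \o phi) (g \o phi) A B s.
Proof.
move=> clTt clT phi_mono sTt; rewrite /upper_sum size_map.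
apply: eq_big_nat => j /= js.
rewrite -map_cons !(nth_map B) ?ltnS ?size_map//; last exact: ltnW.
have nthTt i : (i < (size s).+1)%N -> Tt (nth B (A :: s) i).
  by move=> ilt; apply/set_mem/sTt/mem_nth.
have Tj := nthTt j (ltnW js); have TSj := nthTt j.+1 js.
by rewrite -image_box_itv// image_comp.
Qed.

Lemma lower_sum_map (R : realType) (bx : box) (Tt : set R) (phi f g : R -> R)
    (A B : R) (s : seq R) :
  closed Tt -> closed (phi @` Tt) ->
  {in Tt &, {mono phi : x y / x <= y}} -> {subset A :: s <= Tt} ->
  lower_sum bx (phi @` Tt) f g (phi A) (phi B) (map phi s) =
  lower_sum bx Tt (f \o phi) (g \o phi) A B s.
Proof.
move=> clTt clT phi_mono sTt; rewrite /lower_sum size_map.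
apply: eq_big_nat => j /= js.
rewrite -map_cons !(nth_map B) ?ltnS ?size_map//; last exact: ltnW.
have nthTt i : (i < (size s).+1)%N -> Tt (nth B (A :: s) i).
  by move=> ilt; apply/set_mem/sTt/mem_nth.
have Tj := nthTt j (ltnW js); have TSj := nthTt j.+1 js.
by rewrite -image_box_itv// image_comp.
Qed.

Lemma seq_image_lift (T U : eqType) (D : set T) (h : T -> U) (s : seq U) :
  (forall y, y \in s -> (h @` D) y) ->
  exists2 r, (forall x, x \in r -> D x) & s = map h r.
Proof.
elim: s => [|y s IH] sD; first by exists [::].
have [x Dx <-] := sD y (mem_head _ _).
have [z zs|r rD ->] := IH; first by apply: sD; rewrite inE zs orbT.
by exists (x :: r) => // z; rewrite inE => /predU1P[->//|/rD].
Qed.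

(** Surjectivity is the substantial inclusion: it lets an infimum or supremum
    over all partitions in [phi @` Tt] be taken over the images of partitions in
    [Tt] only. *)
Lemma image_ts_partition (R : realType) (Tt : set R) (phi : R -> R) (A B : R) :
  {in Tt &, {mono phi : x y / x <= y}} -> Tt A -> Tt B ->
  ts_partition (phi @` Tt) (phi A) (phi B) =
  map phi @` ts_partition Tt A B.
Proof.
move=> phi_mono TtA TtB; have lt_mono := leW_mono_in phi_mono.
have phi_inj := inc_inj_in phi_mono.
have itvE s : {subset A :: s <= Tt} ->
    itv_partition (phi A) (phi B) (map phi s) <-> itv_partition A B s.
  move=> sTt; rewrite /itv_partition last_map.
  rewrite (mono_path_in lt_mono); last exact/allP.
  have lastTt : last A s \in Tt by apply/sTt/mem_last.
  by rewrite (inj_in_eq phi_inj)//; exact: mem_set.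
apply/seteqP; split => [t [tp tT]|_ [s [sp sT] <-]]; last first.
  have sTt : {subset A :: s <= Tt} by move=> x /sT[_ Ttx]; rewrite inE.
  split; first exact/itvE.
  move=> y; rewrite -map_cons => /mapP[x /sT xAB ->].
  by rewrite -image_ts_itv//; exists x.
have [y yt|s sT tE] := @seq_image_lift _ _ (ts_itv Tt A B) phi t.
  by rewrite image_ts_itv//; apply: tT; rewrite inE yt orbT.
have sT' x : x \in A :: s -> ts_itv Tt A B x.
  rewrite inE => /predU1P[->|/sT//].
  have [+ _] := tT (phi A) (mem_head _ _).
  by rewrite /= in_itv/= !phi_mono ?inE// => AB; split; rewrite //= in_itv.
exists s => //; split=> //; apply/itvE; last by rewrite -tE.
by move=> x /sT'[_ Ttx]; rewrite inE.
Qed.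

Lemma upper_integral_image (R : realType) (bx : box) (Tt : set R)
    (phi f g : R -> R) (A B : R) :
  closed Tt -> closed (phi @` Tt) ->
  {in Tt &, {mono phi : x y / x <= y}} -> Tt A -> Tt B ->
  upper_integral bx (phi @` Tt) f g (phi A) (phi B) =
  upper_integral bx Tt (f \o phi) (g \o phi) A B.
Proof.
move=> clTt clT phi_mono TtA TtB; rewrite /upper_integral.
rewrite image_ts_partition// image_comp; congr inf.
apply: eq_imagel => s [_ sT]; apply: upper_sum_map => //.
by move=> x /sT[_ Ttx]; rewrite inE.
Qed.

Lemma lower_integral_image (R : realType) (bx : box) (Tt : set R)
    (phi f g : R -> R) (A B : R) :
  closed Tt -> closed (phi @` Tt) ->
  {in Tt &, {mono phi : x y / x <= y}} -> Tt A -> Tt B ->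
  lower_integral bx (phi @` Tt) f g (phi A) (phi B) =
  lower_integral bx Tt (f \o phi) (g \o phi) A B.
Proof.
move=> clTt clT phi_mono TtA TtB; rewrite /lower_integral.
rewrite image_ts_partition// image_comp; congr sup.
apply: eq_imagel => s [_ sT]; apply: lower_sum_map => //.
by move=> x /sT[_ Ttx]; rewrite inE.
Qed.

(** * Change of variables *)

(** Each interval contains its endpoints, so [phi A] and [a] bound each other,
    and likewise [phi B] and [b]. *)
Lemma image_ts_itv_endpoints (R : realType) (Tt T : set R) (phi : R -> R)
    (A B a b : R) :
  {in Tt &, {mono phi : x y / x <= y}} ->
  Tt A -> Tt B -> A <= B -> T a -> T b -> a <= b ->
  phi @` ts_itv Tt A B = ts_itv T a b -> phi A = a /\ phi B = b.
Proof.
move=> phi_mono TtA TtB AB Ta Tb ab phi_itv.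
have [+ _] : ts_itv T a b (phi A).
  by rewrite -phi_itv; exists A => //; split; rewrite //= in_itv/= lexx.
have [+ _] : ts_itv T a b (phi B).
  by rewrite -phi_itv; exists B => //; split; rewrite //= in_itv/= lexx andbT.
rewrite /= !in_itv/= => /andP[_ Bb] /andP[aA _].
have [x [/= + Ttx] xa] : (phi @` ts_itv Tt A B) a.
  by rewrite phi_itv; split; rewrite //= in_itv/= lexx.
have [y [/= + Tty] yb] : (phi @` ts_itv Tt A B) b.
  by rewrite phi_itv; split; rewrite //= in_itv/= lexx andbT.
rewrite !in_itv/= => /andP[_ yB] /andP[Ax _].
by split; apply/eqP; rewrite eq_le ?aA ?Bb ?andbT/= -?xa -?yb phi_mono ?inE.
Qed.

Theorem theorem3p8 (R : realType) (Tt T : set R) (phi : R -> R)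
    (hTt : time_scale Tt)
    (phi_incr : {in Tt &, {homo phi : x y / x < y}})
    (phi_cont : {within Tt, continuous phi})
    (phiT : phi @` Tt = T)
    (hT : time_scale T)
    (A B a b : R)
    (TtA : Tt A) (TtB : Tt B) (ltAB : A < B)
    (Ta : T a) (Tb : T b) (ltab : a < b)
    (phi_itv : phi @` ts_itv Tt A B = ts_itv T a b)
    (bx : box) (g : R -> R)
    (g_incr : {in ts_itv T a b &, {homo g : x y / x < y}})
    (f : R -> R) (hf : RS_integrable bx T g a b f) :
  RS_integrable bx Tt (g \o phi) A B (f \o phi) /\
  RS_integral bx T f g a b = RS_integral bx Tt (f \o phi) (g \o phi) A B.
Proof.
have phi_mono := le_mono_in phi_incr.
have [phiA phiB] :=
  image_ts_itv_endpoints _ _ _ _ _ _ _ _ phi_mono TtA TtB (ltW ltAB)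
  Ta Tb (ltW ltab) phi_itv.
case: hTt hT hf => _ clTt [_ clT] [f_bnd f_int]; subst T a b.
rewrite /RS_integral upper_integral_image//; split => //; split; last first.
  by rewrite -upper_integral_image// -lower_integral_image.
case: f_bnd => M [M_real fM]; exists M; split => // K MK x xAB.
by apply: fM MK _ _; rewrite /= -phi_itv; exists x.
Qed.
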